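(* There exists an infinite CAT(0) cube complex $\mathcal{X}$ on which, for every $\omega \in \{0,1,2\}^\infty$, the Grigorchuk group $G_\omega$ acts without bounded orbit.
   Context: Grigorchuk groups: let $\mathcal{T}_2$ be the infinite binary rooted tree, whose vertices are the finite binary sequences. Let $\sigma$ be the shift on $\{0,1,2\}^\infty$. For $\omega=\omega_1\omega_2\ldots \in \{0,1,2\}^\infty$, $G_\omega$ is the subgroup of $\mathrm{Aut}(\mathcal{T}_2)$ generated by $a, b_\omega, c_\omega, d_\omega$, where, for all binary sequences $x$, $a(0x)=1x$, $a(1x)=0x$, and $b_\omega(0x) = 0a(x)$ if $\omega_1 \neq 2$, $b_\omega(0x)=0x$ if $\omega_1=2$, $b_\omega(1x)=1b_{\sigma\omega}(x)$; $c_\omega(0x) = 0a(x)$ if $\omega_1 \neq 1$, $c_\omega(0x)=0x$ if $\omega_1=1$, $c_\omega(1x)=1c_{\sigma\omega}(x)$; $d_\omega(0x) = 0a(x)$ if $\omega_1 \neq 0$, $d_\omega(0x)=0x$ if $\omega_1=0$, $d_\omega(1x)=1d_{\sigma\omega}(x)$. A CAT(0) cube complex is a cube complex (Euclidean unit cubes glued along faces by isometries) which is simply connected and satisfies the usual flag (nonpositive curvature) condition on links, endowed with the induced CAT(0) metric. Actions on cube complexes are by cubical automorphisms, and boundedness of orbits is with respect to this metric. *)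

(* Defs.v *)
From HB Require Import structures.
From mathcomp Require Import all_boot all_order all_algebra.
From mathcomp Require Import all_classical all_reals all_analysis.

Set Implicit Arguments.
Unset Strict Implicit.
Unset Printing Implicit Defensive.

Import Order.TTheory GRing.Theory Num.Theory.
Import numFieldNormedType.Exports.

Local Open Scope classical_set_scope.
Local Open Scope ring_scope.

Section EuclideanCubes.
Variable R : realType.

(* The library's norm on 'rV[R]_n is the sup norm, hence this definition. *)
Definition edist n (u v : 'rV[R]_n) : R :=
  Num.sqrt (\sum_(i < n) (u 0 i - v 0 i) ^+ 2).

Definition cube n : set 'rV[R]_n := [set u | forall i, 0 <= u 0 i <= 1].

(* Faces are coded by partial assignments: the coordinate i is frozen to 0 or 1
   when s i = Some b, and free when s i = None. The whole cube and its vertices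
   are faces. *)
Definition face n (s : 'I_n -> option bool) : set 'rV[R]_n :=
  [set u | cube u /\ forall i b, s i = Some b -> u 0 i = b%:R].

Definition face_dim n (s : 'I_n -> option bool) : nat :=
  #|[pred i | s i == None]|.

Definition isometry_onto n m (A : set 'rV[R]_n) (B : set 'rV[R]_m)
    (h : 'rV[R]_n -> 'rV[R]_m) : Prop :=
  h @` A = B /\ forall u v, A u -> A v -> edist (h u) (h v) = edist u v.

End EuclideanCubes.

(* Cubical complexes in the sense of Bridson and Haefliger (Metric spaces of
   non-positive curvature, I.7.32). By chart_onto the set of points is the
   quotient of the disjoint union of the cubes by the relation "same image";
   chart_glue describes this relation: the cubes are glued along isometric
   faces. Only the restriction of a chart to the unit cube is relevant. *)
Record cube_complex (R : realType) := CubeComplex {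
  points : Type;
  cubes : Type;
  cube_dim : cubes -> nat;
  chart : forall l, 'rV[R]_(cube_dim l) -> points;
  chart_onto : forall y, exists l, exists2 u, cube u & @chart l u = y;
  chart_inj : forall l u v,
    cube u -> cube v -> @chart l u = @chart l v -> u = v;
  chart_glue : forall l m,
    (@chart l @` @cube R _) `&` (@chart m @` @cube R _) !=set0 ->
    exists (s : 'I_(cube_dim l) -> option bool)
           (t : 'I_(cube_dim m) -> option bool) h,
      isometry_onto (@face R _ s) (@face R _ t) h /\
      forall u v, cube u -> cube v ->
        (@chart l u = @chart m v <-> face s u /\ h u = v)
}.
Arguments chart {R} X l u : rename.

Section Metric.
Variables (R : realType) (X : cube_complex R).

(* cc_string x y L: there is a finite sequence of points from x to y, any two
   consecutive ones lying in a common cube, of total length L. *)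
Inductive cc_string : points X -> points X -> R -> Prop :=
| cc_string_nil x : cc_string x x 0
| cc_string_cons l u v y L : cube u -> cube v -> cc_string (chart X l v) y L ->
    cc_string (chart X l u) y (edist u v + L).

(* The induced length (pseudo)metric; +oo between different components. *)
Definition cc_dist (x y : points X) : \bar R :=
  ereal_inf [set L%:E | L in cc_string x y].

Definition cc_ball (x : points X) (e : R) : set (points X) :=
  [set y | (cc_dist x y < e%:E)%E].

Lemma edistC n (u v : 'rV[R]_n) : edist u v = edist v u.
Proof.
by congr Num.sqrt; apply: eq_bigr => i _; rewrite -opprB sqrrN.
Qed.

Lemma cc_string_trans x y z L M : cc_string x y L -> cc_string y z M ->
  cc_string x z (L + M).
Proof.
move=> s; elim: s z M => {x y L} [x|l u v y L cu cv _ IH] z M syz.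
  by rewrite add0r.
by rewrite -addrA; apply: cc_string_cons => //; exact: IH.
Qed.

Lemma cc_string_sym x y L : cc_string x y L -> cc_string y x L.
Proof.
elim=> {x y L} [x|l u v y L cu cv _ IH]; first exact: cc_string_nil.
rewrite addrC -[edist _ _]addr0 edistC.
by apply: (cc_string_trans IH); apply: cc_string_cons => //; exact: cc_string_nil.
Qed.

Lemma cc_ballP x e y : cc_ball x e y <-> exists2 L, cc_string x y L & L < e.
Proof.
split.
  move=> /ereal_inf_lt[_ [L sL <-]]; rewrite lte_fin => Le.
  by exists L.
move=> [L sL Le]; rewrite /cc_ball /=.
apply: (@le_lt_trans _ _ L%:E); last by rewrite lte_fin.
by apply: ereal_inf_lbound; exists L.
Qed.

Lemma cc_ball_center x (e : R) : 0 < e -> cc_ball x e x.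
Proof. by move=> e0; apply/cc_ballP; exists 0 => //; exact: cc_string_nil. Qed.

Lemma cc_ball_sym x y (e : R) : cc_ball x e y -> cc_ball y e x.
Proof.
by move=> /cc_ballP[L sL Le]; apply/cc_ballP; exists L => //; exact: cc_string_sym.
Qed.

Lemma cc_ball_triangle x y z (e f : R) :
  cc_ball x e y -> cc_ball y f z -> cc_ball x (e + f) z.
Proof.
move=> /cc_ballP[L sL Le] /cc_ballP[M sM Mf]; apply/cc_ballP.
by exists (L + M); [exact: cc_string_trans sL sM | exact: ltrD].
Qed.

(* The topology put on a complex is the metric one, not the CW topology. *)
Definition cc_ent : set_system (points X * points X) := entourage_ cc_ball.

HB.instance Definition _ := gen_eqMixin (points X).
HB.instance Definition _ := gen_choiceMixin (points X).
HB.instance Definition _ := hasNbhs.Build (points X) (nbhs_ cc_ent).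
HB.instance Definition _ := Nbhs_isPseudoMetric.Build R (points X)
  erefl cc_ball_center cc_ball_sym cc_ball_triangle erefl.

Definition cc_bounded (A : set (points X)) : Prop :=
  exists M : R, forall x y, A x -> A y -> (cc_dist x y <= M%:E)%E.

End Metric.

Definition simply_connected (R : realType) (T : topologicalType) : Prop :=
  (forall x y : T, exists f : R -> T,
     [/\ {within `[0, 1], continuous f}, f 0 = x & f 1 = y]) /\
  (forall f : R -> T, {within `[0, 1], continuous f} -> f 0 = f 1 ->
     exists H : R * R -> T,
       {within `[0, 1] `*` `[0, 1], continuous H} /\
       forall s, s \in `[0, 1] ->
         [/\ H (s, 0) = f s, H (s, 1) = f 0, H (0, s) = f 0 & H (1, s) = f 0]).

Section Cat0.
Variables (R : realType) (X : cube_complex R).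

Definition cell (k : nat) (A : set (points X)) : Prop :=
  exists l (s : 'I_(cube_dim l) -> option bool),
    face_dim s = k /\ A = chart X l @` face s.

(* The link of a vertex v as an abstract simplicial complex: its vertices are
   the edges at v, and the edges at v of each cube containing v span a simplex.
   By chart_glue, a cube containing v is determined by its edges at v, so that
   no information on the link is lost. The empty simplex is included. *)
Definition link (v : points X) (S : set (set (points X))) : Prop :=
  exists k C, [/\ cell k C, C v &
    S = [set E | [/\ cell 1 E, E v & E `<=` C]]].

Definition flag (V : Type) (K : set V -> Prop) : Prop :=
  forall S : set V, finite_set S ->
    (forall x y, S x -> S y -> K [set x; y]) -> K S.

Definition cat0 : Prop :=
  simply_connected R (points X) /\
  forall v : points X, cell 0 [set v] -> flag (link v).

Definition infinite_complex : Prop :=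
  infinite_set [set A | exists k, cell k A].

Definition cubical (f : points X -> points X) : Prop :=
  forall l, exists m (t : 'I_(cube_dim m) -> option bool) h,
    isometry_onto (@cube R (cube_dim l)) (face t) h /\
    forall u, cube u -> f (chart X l u) = chart X m (h u).

Definition cubical_automorphism (f : points X -> points X) : Prop :=
  exists g, [/\ cancel f g, cancel g f, cubical f & cubical g].

Definition cubical_action (G : groupType) (act : G -> points X -> points X) :=
  [/\ forall g, cubical_automorphism (act g),
      forall x, act 1%g x = x &
      forall g h x, act (g * h)%g x = act g (act h x)].

Definition without_bounded_orbit (G : groupType)
    (act : G -> points X -> points X) : Prop :=
  forall x, ~ cc_bounded [set act g x | g in [set: G]].

End Cat0.

Section GeneratedSubgroup.
Variables (G : groupType) (A : set G).

Definition generated : set G :=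
  smallest [set S : set G | group_closed (mem S)] A.

Record gen_subgroup := GenSubgroup {
  gen_val : G;
  _ : gen_val \in generated }.

Lemma generated_closed : group_closed (mem generated).
Proof.
split=> [|x y].
  by rewrite inE => S [[+ _] _]; rewrite inE.
rewrite !inE => Hx Hy S HS; have [[_ SM] _] := HS.
by have := SM x y; rewrite !inE; apply; [exact: Hx|exact: Hy].
Qed.

HB.instance Definition _ := [isSub for gen_val].
HB.instance Definition _ := [Choice of gen_subgroup by <:].
HB.instance Definition _ := SubChoice_isSubGroup.Build G
  (mem generated) gen_subgroup generated_closed.

End GeneratedSubgroup.

(* The vertices of the binary rooted tree are the finite sequences of booleans,
   with false for the letter 0 and true for the letter 1; the root is [::]. *)
Definition tree_adj (x y : seq bool) : Prop :=
  (exists b, y = rcons x b) \/ (exists b, x = rcons y b).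

Record tree_aut := TreeAut {
  taut :> seq bool -> seq bool;
  taut_inv : seq bool -> seq bool;
  tautK : cancel taut taut_inv;
  taut_invK : cancel taut_inv taut;
  taut_root : taut [::] = [::];
  taut_adj : forall x y, tree_adj (taut x) (taut y) <-> tree_adj x y }.

Lemma tree_autP (f g : tree_aut) : f =1 g -> f = g.
Proof.
case: f g => [f f' fK f'K fr fa] [g g' gK g'K gr ga] /= /funext fg.
subst g; have fg' : f' = g' by apply/funext => x; rewrite -[in LHS](g'K x) fK.
by subst g'; congr TreeAut; exact: Prop_irrelevance.
Qed.

HB.instance Definition _ := gen_eqMixin tree_aut.
HB.instance Definition _ := gen_choiceMixin tree_aut.

Definition taut1 : tree_aut :=
  @TreeAut id id (fun=> erefl) (fun=> erefl) erefl (fun _ _ => iff_refl _).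

Program Definition tautV (f : tree_aut) : tree_aut :=
  @TreeAut (taut_inv f) f (taut_invK f) (@tautK f) _ _.
Next Obligation. by move=> f; rewrite -[in LHS](taut_root f) tautK. Qed.
Next Obligation. by move=> f x y; rewrite -(taut_adj f) !taut_invK. Qed.

Program Definition tautM (f g : tree_aut) : tree_aut :=
  @TreeAut (f \o g) (taut_inv g \o taut_inv f) _ _ _ _.
Next Obligation. by move=> f g; apply: can_comp; exact: tautK. Qed.
Next Obligation. by move=> f g; apply: can_comp; exact: taut_invK. Qed.
Next Obligation. by move=> f g /=; rewrite !taut_root. Qed.
Next Obligation. by move=> f g x y /=; rewrite !taut_adj. Qed.

Lemma tautA : associative tautM. Proof. by move=> f g h; exact: tree_autP. Qed.
Lemma taut1g : left_id taut1 tautM. Proof. by move=> f; exact: tree_autP. Qed.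
Lemma tautg1 : right_id taut1 tautM. Proof. by move=> f; exact: tree_autP. Qed.
Lemma tautVg : left_inverse taut1 tautV tautM.
Proof. by move=> f; apply: tree_autP => x; exact: tautK. Qed.
Lemma tautgV : right_inverse taut1 tautV tautM.
Proof. by move=> f; apply: tree_autP => x; exact: taut_invK. Qed.

HB.instance Definition _ :=
  isGroup.Build tree_aut tautA taut1g tautg1 tautVg tautgV.

Definition swap_first (x : seq bool) : seq bool :=
  if x is e :: y then ~~ e :: y else [::].

Definition shift_seq (w : nat -> 'I_3) : nat -> 'I_3 := fun n => w n.+1.

(* w 0 is the first letter of w; k = 2, 1, 0 give b, c, d respectively. *)
Fixpoint spinal (k : nat) (w : nat -> 'I_3) (x : seq bool) : seq bool :=
  match x with
  | [::] => [::]
  | false :: y => false :: (if w 0%N == k :> nat then y else swap_first y)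
  | true :: y => true :: spinal k (shift_seq w) y
  end.

Lemma swapK : involutive swap_first.
Proof. by case=> //= e y; rewrite negbK. Qed.

Lemma swap_rcons x e : exists e', swap_first (rcons x e) = rcons (swap_first x) e'.
Proof. by case: x => [|e1 x] /=; [exists (~~ e)|exists e]. Qed.

Lemma spinalK k w : involutive (spinal k w).
Proof.
move=> x; elim: x w => [//|[] x IH] w /=; first by rewrite IH.
by case: ifP => ->; rewrite ?swapK.
Qed.

Lemma spinal_rcons k w x e :
  exists e', spinal k w (rcons x e) = rcons (spinal k w x) e'.
Proof.
elim: x w => [|[] x IH] w /=.
- by exists e; case: e => //=; case: ifP.
- by have [e' ->] := IH (shift_seq w); exists e'.
- case: ifP => _; first by exists e.
  by have [e' ->] := swap_rcons x e; exists e'.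
Qed.

Lemma inv_adj (f : seq bool -> seq bool) (fK : involutive f)
    (f_rcons : forall x e, exists e', f (rcons x e) = rcons (f x) e') x y :
  tree_adj (f x) (f y) <-> tree_adj x y.
Proof.
have H u v : tree_adj u v -> tree_adj (f u) (f v).
  by case=> -[e ->]; [left|right]; exact: f_rcons.
by split=> [/H|/H //]; rewrite !fK.
Qed.

Definition gen_a : tree_aut :=
  TreeAut swapK swapK erefl (inv_adj swapK swap_rcons).

Definition gen_spinal k w : tree_aut :=
  TreeAut (spinalK k w) (spinalK k w) erefl
    (inv_adj (spinalK k w) (spinal_rcons k w)).

Definition gen_b w := gen_spinal 2 w.
Definition gen_c w := gen_spinal 1 w.
Definition gen_d w := gen_spinal 0 w.

Definition grigorchuk (w : nat -> 'I_3) : groupType :=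
  gen_subgroup [set gen_a; gen_b w; gen_c w; gen_d w].

(* Main.v *)
From HB Require Import structures.
From mathcomp Require Import all_boot all_order all_algebra.
From mathcomp Require Import all_classical all_reals all_analysis.
From mathcomp Require Import finmap ring lra zify.
Require Import Defs.

(** Let I be a set and M a subset of I. The functions from I to [0, 1] that differ
    from the indicator function o of M at finitely many indices form a cube
    complex, an infinite cube: its vertices are the subsets of I at finite
    distance from M, and its cubes are obtained by letting finitely many
    coordinates vary. Any two points lie in a common cube
    (common_cube), so that the length metric is the Euclidean distance
    (cc_distE), straight-line homotopies contract everything
    (infinite_cube_simply_connected), and the link of a vertex is the full
    simplex on I (infinite_cube_flag). Hence the complex is CAT(0).

    A group of permutations g of I such that M and gM differ at finitely many
    indices acts on this complex (move_cubical_action), and the squared distance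
    from M to gM is the number of these indices. If M and its complement are
    infinite and the action is sufficiently transitive, this number is unbounded
    (displacement_unbounded): otherwise M would be almost equal to an invariant
    set. Then no orbit is bounded (unbounded_displacement_orbit).

    For the Grigorchuk groups, I is the set of all rays of the binary tree, and M
    is the set of the rays having a last letter 1, at an even position
    (half_line). In the Schreier graph of the orbit of 000..., which is a line,
    M is one of the two half-lines obtained by deleting an edge labelled by a.
    Neither I nor M depends on w, and for every w the generators b, c, d preserve
    M, while a exchanges two points across the deleted edge
    (grig_displaced_fin). Any two rays with a common tail are in the same orbit
    (cofinal_same_orbit), which gives the transitivity needed. *)

Set Implicit Arguments.
Unset Strict Implicit.
Unset Printing Implicit Defensive.

Import Order.TTheory GRing.Theory Num.Theory.
Import numFieldNormedType.Exports.

Local Open Scope classical_set_scope.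
Local Open Scope ring_scope.

(** * The Euclidean distance of functions that differ at finitely many indices *)

Section EuclideanDistance.
Variables (R : realType) (I : choiceType).
Implicit Types x y z : I -> R.

(** A sum over all indices whose support is infinite is 0 by convention, so
    these are the squared distance and the distance only when x and y differ at
    finitely many indices. *)
Definition sqd x y : R := \sum_(i \in [set: I]) (x i - y i) ^+ 2.

Definition l2 x y : R := Num.sqrt (sqd x y).

Lemma sqdE (s : seq I) x y : uniq s -> (forall i, i \notin s -> x i = y i) ->
  sqd x y = \sum_(i <- s) (x i - y i) ^+ 2.
Proof.
move=> us xy; rewrite fsbig_seq //; apply/esym/fsbig_widen => //.
by move=> i [_ /= /negP /xy ->]; rewrite subrr expr0n.
Qed.

Lemma sqd_ge0 x y : 0 <= sqd x y.
Proof. by apply: fsumr_ge0 => i _; exact: sqr_ge0. Qed.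

Lemma l2_ge0 x y : 0 <= l2 x y. Proof. exact: sqrtr_ge0. Qed.

Lemma sqr_l2 x y : l2 x y ^+ 2 = sqd x y.
Proof. by rewrite sqr_sqrtr // sqd_ge0. Qed.

Lemma l2C x y : l2 x y = l2 y x.
Proof.
by congr Num.sqrt; apply: eq_fsbigr => i _; rewrite -opprB sqrrN.
Qed.

Lemma finite_support_seq (A : set I) : finite_set A ->
  exists2 s : seq I, uniq s & forall i, A i <-> i \in s.
Proof.
move=> /finite_seqP[s ->]; exists (undup s); first exact: undup_uniq.
by move=> i; rewrite mem_undup.
Qed.

(** The quadratic form sum_i (p x_i - q y_i)^2 in (p, q) is nonnegative; it is
    evaluated at the point where it gives the discriminant. *)
Lemma cauchy_schwarz (s : seq I) x y :
  (\sum_(i <- s) x i * y i) ^+ 2 <=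
  (\sum_(i <- s) x i ^+ 2) * (\sum_(i <- s) y i ^+ 2).
Proof.
set A := \sum_(i <- s) x i ^+ 2; set B := \sum_(i <- s) y i ^+ 2.
set C := \sum_(i <- s) _.
have A0 : 0 <= A by apply: sumr_ge0 => i _; exact: sqr_ge0.
have B0 : 0 <= B by apply: sumr_ge0 => i _; exact: sqr_ge0.
have H p q : 0 <= p ^+ 2 * A - 2 * p * q * C + q ^+ 2 * B.
  have -> : p ^+ 2 * A - 2 * p * q * C + q ^+ 2 * B =
      \sum_(i <- s) (p * x i - q * y i) ^+ 2.
    rewrite !big_distrr -sumrN -!big_split /=.
    by apply: eq_bigr => i _; ring.
  by apply: sumr_ge0 => i _; exact: sqr_ge0.
have [B00|Bn0] := eqVneq B 0.
  by have := H C (A + 1); rewrite B00; nra.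
have Bp : 0 < B by rewrite lt_def Bn0.
have := H B C.
rewrite (_ : _ + _ = B * (A * B - C ^+ 2)); last by ring.
by rewrite pmulr_rge0 // subr_ge0.
Qed.

Lemma l2_triangle x y z : finite_set [set i | x i != y i] ->
  finite_set [set i | y i != z i] -> l2 x z <= l2 x y + l2 y z.
Proof.
move=> fxy fyz.
have [s us sP] : exists2 s : seq I, uniq s &
    forall i, i \notin s -> x i = y i /\ y i = z i.
  have : finite_set ([set i | x i != y i] `|` [set i | y i != z i]).
    by rewrite finite_setU.
  move=> /finite_support_seq[s us sP]; exists s => // i /negP is_.
  by split; apply/eqP/negPn/negP => ne; apply: is_; apply/sP; [left|right].
have Exy : sqd x y = \sum_(i <- s) (x i - y i) ^+ 2.
  by apply: sqdE => // i /sP[].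
have Eyz : sqd y z = \sum_(i <- s) (y i - z i) ^+ 2.
  by apply: sqdE => // i /sP[].
have Exz : sqd x z = \sum_(i <- s) (x i - z i) ^+ 2.
  by apply: sqdE => // i /sP[-> ->].
rewrite -(@ler_pXn2r _ 2) ?nnegrE ?addr_ge0 ?l2_ge0 // sqrrD !sqr_l2.
have -> : sqd x z = sqd x y + (\sum_(i <- s) (x i - y i) * (y i - z i)) *+ 2
    + sqd y z.
  rewrite Exy Eyz Exz -sumrMnl -!big_split /=.
  by apply: eq_bigr => i _; ring.
rewrite lerD2r lerD2l lerMn2r /=; apply: (le_trans (ler_norm _)).
rewrite -(@ler_pXn2r _ 2) ?nnegrE ?mulr_ge0 ?l2_ge0 ?normr_ge0 //.
rewrite -normrX ger0_norm ?sqr_ge0 // exprMn !sqr_l2 Exy Eyz.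
exact: cauchy_schwarz.
Qed.

Lemma l2_bool_card (p q : I -> bool) (D : {fset I}) :
  (forall i, (i \in D) = (p i != q i)) ->
  sqd (fun i => (p i)%:R) (fun i => (q i)%:R) = #|` D|%:R.
Proof.
move=> DP; rewrite (@sqdE D) ?fset_uniq //; last first.
  by move=> i; rewrite DP negbK => /eqP ->.
rewrite (eq_big_seq (fun=> 1)); last first.
  by move=> i; rewrite DP; case: (p i) (q i) => -[] //= _; ring.
by rewrite big_const_seq count_predT iter_addr_0.
Qed.

End EuclideanDistance.

(** * The infinite cube based at a vertex o *)

Section InfiniteCube.
Variables (R : realType) (I : choiceType) (o : I -> bool).

Record point := Point {
  coord :> I -> R;
  coord01 : forall i, 0 <= coord i <= 1;
  coord_fin : finite_set [set i | coord i != (o i)%:R] }.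

Lemma point_eq (x y : point) : x =1 y :> (I -> R) -> x = y.
Proof.
case: x y => [x x1 xf] [y y1 yf] /= /funext xy; subst y.
by congr Point; exact: Prop_irrelevance.
Qed.

Lemma point_diff (x y : point) : finite_set [set i | x i != y i].
Proof.
apply: (@sub_finite_set _ _
  ([set i | x i != (o i)%:R] `|` [set i | y i != (o i)%:R])).
  move=> i /= xy; apply/orP; rewrite -negb_and; apply: contraNN xy.
  by move=> /andP[/eqP -> /eqP ->].
by rewrite finite_setU; split; exact: coord_fin.
Qed.

(** A cube is given by its directions and by the values of the other
    coordinates. Enumerating the directions by ordinals yields charts directly;
    it gives every geometric cube several labels, which are glued along their
    whole cube. *)
Record label := Label {
  dim : nat;
  dir : 'I_dim -> I;
  dir_inj : injective dir;
  base : I -> bool;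
  base_fin : finite_set [set i | base i != o i] }.

Definition along l i := [exists j, @dir l j == i].

(** Coordinates of the point that u represents in the cube l; restr is its left
    inverse. All gluing statements reduce to equalities of such functions. *)
Definition ext l (u : 'rV[R]_(dim l)) (i : I) : R :=
  if [pick j | dir j == i] is Some j then u 0 j else (base l i)%:R.

Definition restr l (x : I -> R) : 'rV[R]_(dim l) := \row_j x (@dir l j).

Lemma along_dir l j : along l (@dir l j).
Proof. by apply/existsP; exists j. Qed.

Lemma ext_dir l (u : 'rV_(dim l)) j : ext u (dir j) = u 0 j.
Proof.
rewrite /ext; case: pickP => [k /eqP /(@dir_inj l) -> //|/(_ j)].
by rewrite eqxx.
Qed.

Lemma ext_off l (u : 'rV_(dim l)) i : ~~ along l i -> ext u i = (base l i)%:R.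
Proof.
move=> /existsPn li; rewrite /ext; case: pickP => // k dk.
by have := li k; rewrite dk.
Qed.

Lemma extK l : cancel (@ext l) (@restr l).
Proof. by move=> u; apply/rowP => j; rewrite mxE ext_dir. Qed.

Lemma restrK l (x : I -> R) : (forall i, ~~ along l i -> x i = (base l i)%:R) ->
  ext (restr l x) = x.
Proof.
move=> xl; apply/funext => i.
have [/existsP[j /eqP <-]|li] := boolP (along l i); first by rewrite ext_dir mxE.
by rewrite ext_off // xl.
Qed.

Lemma ext01 l (u : 'rV_(dim l)) i : cube u -> 0 <= ext u i <= 1.
Proof.
move=> cu; have [/existsP[j /eqP <-]|li] := boolP (along l i).
  by rewrite ext_dir.
by rewrite ext_off //; case: (base l i) => /=; rewrite lexx ler01.
Qed.

Lemma finite_along l : finite_set [set i | along l i].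
Proof.
apply: (@sub_finite_set _ _ [set` codom (@dir l)]); last exact: finite_seq.
by move=> i /existsP[j /eqP <-]; exact: codom_f.
Qed.

Lemma ext_fin l (u : 'rV_(dim l)) : finite_set [set i | ext u i != (o i)%:R].
Proof.
apply: (@sub_finite_set _ _
  ([set i | along l i] `|` [set i | base l i != o i])).
  move=> i /=; have [li _|li] := boolP (along l i); first by left.
  by rewrite ext_off // => ne; right; apply: contraNN ne => /eqP ->.
by rewrite finite_setU; split; [exact: finite_along | exact: base_fin].
Qed.

Lemma differ_refl_fin (T : eqType) (f : I -> T) :
  finite_set [set i | f i != f i].
Proof.
by rewrite (_ : mkset _ = set0) //; apply/seteqP; split => i //=; rewrite eqxx.
Qed.

Section Vertex.
Variable b : I -> bool.
Hypothesis b_fin : finite_set [set i | b i != o i].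

Lemma vertex01 i : 0 <= ((b i)%:R : R) <= 1.
Proof. by case: (b i); rewrite /= ?lexx ?ler01. Qed.

Lemma vertex_fin : finite_set [set i | ((b i)%:R : R) != (o i)%:R].
Proof. by apply: sub_finite_set b_fin => i /=; apply: contraNN => /eqP ->. Qed.

Definition vertex : point := Point vertex01 vertex_fin.

End Vertex.

Definition origin : point := vertex (differ_refl_fin o).

(** Charts must be defined on all of R^n: the origin is a dummy value outside
    of the unit cube. *)
Definition to_point l (u : 'rV[R]_(dim l)) : point :=
  match pselect (cube u) with
  | left cu => Point (fun i => ext01 i cu) (ext_fin u)
  | right _ => origin
  end.

Lemma to_pointE l (u : 'rV_(dim l)) : cube u -> to_point u = ext u :> (I -> R).
Proof. by rewrite /to_point; case: pselect. Qed.

Lemma to_point_restr l (x : point) :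
  (forall i, ~~ along l i -> x i = (base l i)%:R) ->
  cube (restr l x) /\ to_point (restr l x) = x.
Proof.
move=> xl; have cx : cube (restr l x).
  by move=> j; rewrite mxE; exact: coord01.
by split=> //; apply: point_eq => i; rewrite to_pointE // restrK.
Qed.

Section SpannedCube.
Variables (s : seq I) (us : uniq s) (b : I -> bool).
Hypothesis b_fin : finite_set [set i | b i != o i].

Lemma tnth_in_tuple_inj : injective (tnth (in_tuple s)).
Proof. exact/tuple_uniqP. Qed.

Definition spanned : label := Label tnth_in_tuple_inj b_fin.

Lemma along_spanned i : along spanned i = (i \in s).
Proof.
apply/existsP/idP => [[j /eqP <-]|is_]; first exact: mem_tnth.
by have /tnthP[j ->] : i \in in_tuple s by []; exists j.
Qed.
End SpannedCube.

(** Both points agree with o outside of a finite set of indices, and the cube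
    based at o in these directions contains them. This makes the complex convex:
    no string of points is shorter than a single segment. *)
Lemma common_cube (x y : point) : exists l : label, exists2 u, cube u &
  exists2 v, cube v & @to_point l u = x /\ @to_point l v = y.
Proof.
have : finite_set ([set i | x i != (o i)%:R] `|` [set i | y i != (o i)%:R]).
  by rewrite finite_setU; split; exact: coord_fin.
move=> /finite_support_seq[s us sP].
pose l := spanned us (differ_refl_fin o); exists l.
have off (z : point) : (forall i, z i != (o i)%:R -> i \in s) ->
    forall i, ~~ along l i -> z i = (base l i)%:R.
  move=> zs i; rewrite along_spanned => is_; apply/eqP.
  by apply: contraNT is_; exact: zs.
have [cx xE] := to_point_restr (off x (fun i ne => (sP i).1 (or_introl ne))).
have [cy yE] := to_point_restr (off y (fun i ne => (sP i).1 (or_intror ne))).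
by exists (restr l x) => //; exists (restr l y).
Qed.

Lemma edist_ext l (u v : 'rV_(dim l)) : edist u v = l2 (ext u) (ext v).
Proof.
congr Num.sqrt; rewrite (@sqdE _ _ (codom (@dir l))).
- by rewrite big_map big_enum /=; apply: eq_bigr => j _; rewrite !ext_dir.
- by rewrite map_inj_uniq ?enum_uniq //; exact: dir_inj.
- move=> i li; rewrite !ext_off //; apply: contraNN li;
  by move=> /existsP[j /eqP <-]; exact: codom_f.
Qed.

Lemma to_point_onto (x : point) :
  exists l, exists2 u, cube u & @to_point l u = x.
Proof. by have [l [u cu [v _ [ux _]]]] := common_cube x x; exists l, u. Qed.

Lemma to_point_inj l (u v : 'rV_(dim l)) :
  cube u -> cube v -> to_point u = to_point v -> u = v.
Proof.
by move=> cu cv uv; rewrite -(extK u) -(extK v) -!to_pointE // uv.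
Qed.

(** The face of the cube l common to the cubes l and m: a direction of l which is
    not a direction of m is frozen to the value prescribed by m. *)
Definition shared_face l m : 'I_(dim l) -> option bool :=
  fun j => if along m (dir j) then None else Some (base m (dir j)).
Arguments shared_face : clear implicits.

Lemma shared_faceP l m (u : 'rV_(dim l)) :
  (forall i, ~~ along l i -> ~~ along m i -> base l i = base m i) ->
  face (shared_face l m) u <->
  cube u /\ forall i, ~~ along m i -> ext u i = (base m i)%:R.
Proof.
move=> lm; split=> -[cu uf]; split=> //.
  move=> i mi; have [/existsP[j /eqP ji]|li] := boolP (along l i).
    by rewrite -ji ext_dir; apply: uf; rewrite /shared_face ji (negbTE mi).
  by rewrite ext_off // lm.
move=> j b; rewrite /shared_face; case: ifPn => // /uf + [<-].
by rewrite ext_dir.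
Qed.

(** The transition map reads off, in the directions of m, the coordinates of the
    point represented in l. It is isometric because distances in both cubes are
    distances of the same coordinate functions. *)
Lemma to_point_glue l m :
  (@to_point l @` @cube R _) `&` (@to_point m @` @cube R _) !=set0 ->
  exists (s : 'I_(dim l) -> option bool) (t : 'I_(dim m) -> option bool) h,
    isometry_onto (@face R _ s) (@face R _ t) h /\
    forall u v, cube u -> cube v ->
      (@to_point l u = @to_point m v <-> face s u /\ h u = v).
Proof.
move=> [_ [[u0 cu0 <-] [v0 cv0 v0u0]]].
have lm i : ~~ along l i -> ~~ along m i -> base l i = base m i.
  move=> li mi; have := congr1 (fun x : point => x i) v0u0.
  rewrite /= !to_pointE // !ext_off // => /eqP.
  by rewrite eqr_nat; case: (base l i) (base m i) => -[].
have ml i : ~~ along m i -> ~~ along l i -> base m i = base l i.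
  by move=> mi li; rewrite lm.
have faceE k n : (forall i, ~~ along k i -> ~~ along n i ->
    base k i = base n i) -> forall u, face (shared_face k n) u ->
    cube (restr n (ext u)) /\ ext (restr n (ext u)) = ext u.
  move=> kn u /(shared_faceP _ kn)[cu un]; split; last exact: restrK.
  by move=> j; rewrite mxE; exact: ext01.
have eqP_ u v : cube u -> cube v ->
    (@to_point l u = @to_point m v <-> ext u = ext v).
  move=> cu cv; rewrite -!to_pointE //; split=> [-> //|uv].
  by apply: point_eq => i; rewrite uv.
exists (shared_face l m), (shared_face m l), (fun u => restr m (ext u)).
split; first split.
- apply/seteqP; split=> v.
    move=> [u /[dup] /(shared_faceP _ lm)[cu um] /(faceE _ _ lm)[cv vu] <-].
    apply/(shared_faceP _ ml); split=> // i li.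
    by rewrite vu ext_off.
  move=> /[dup] /(shared_faceP _ ml)[cv vl] /(faceE _ _ ml)[cu uv].
  exists (restr l (ext v)); last by rewrite uv extK.
  by apply/(shared_faceP _ lm); split=> // i mi; rewrite uv ext_off.
- move=> u v /(faceE _ _ lm)[_ uE] /(faceE _ _ lm)[_ vE].
  by rewrite !edist_ext uE vE.
- move=> u v cu cv; split=> [/(eqP_ _ _ cu cv) uv|[/(faceE _ _ lm)[_ uE] <-]].
    split; last by rewrite uv extK.
    by apply/(shared_faceP _ lm); split=> // i mi; rewrite uv ext_off.
  apply: point_eq => i; rewrite !to_pointE // ?uE //.
  by move=> j; rewrite mxE; exact: ext01.
Qed.

Definition infinite_cube : cube_complex R :=
  CubeComplex to_point_onto to_point_inj to_point_glue.

End InfiniteCube.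

(** * The length metric is the Euclidean one, and the cube is contractible *)

Section InfiniteCubeMetric.
Variables (R : realType) (I : choiceType) (o : I -> bool).

Local Notation X := (infinite_cube R o).
Implicit Types x y z p : points X.

(** The coordinates of a point, seen through the point set of the complex. *)
Definition crd x : I -> R := coord (x : point R o).

Lemma string_l2 x y : cc_string x y (l2 (crd x) (crd y)).
Proof.
have [l [u cu [v cv [ux vy]]]] := common_cube x y.
have -> : l2 (crd x) (crd y) = edist u v + 0.
  by rewrite addr0 edist_ext -(to_pointE cu) -(to_pointE cv) ux vy.
rewrite -ux -vy; apply: (@cc_string_cons R X l) => //; exact: cc_string_nil.
Qed.

Lemma l2_string x y L : cc_string x y L -> l2 (crd x) (crd y) <= L.
Proof.
elim=> {x y L} [x|l u v y L cu cv _ IH].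
  rewrite (_ : l2 _ _ = 0) // /l2 /sqd fsbig1 ?sqrtr0 // => i _.
  by rewrite subrr expr0n.
apply: (le_trans (l2_triangle (y := crd (chart X l v)) _ _)).
- exact: point_diff.
- exact: point_diff.
- by rewrite lerD // edist_ext /crd /= !to_pointE.
Qed.

Lemma cc_distE x y : cc_dist x y = (l2 (crd x) (crd y))%:E.
Proof.
apply/eqP; rewrite eq_le; apply/andP; split.
  by apply: ereal_inf_lbound; exists (l2 (crd x) (crd y)) => //; exact: string_l2.
by apply: le_ereal_inf_tmp => _ [L /l2_string sL <-]; rewrite lee_fin.
Qed.

Lemma ball_l2 x (e : R) y : ball x e y <-> l2 (crd x) (crd y) < e.
Proof. by rewrite -lte_fin -cc_distE. Qed.

Definition clamp (t : R) : R := Num.max 0 (Num.min 1 t).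

Lemma clamp01 t : 0 <= clamp t <= 1.
Proof. by rewrite /clamp le_max lexx /= ge_max ler01 ge_min lexx. Qed.

Lemma clampE t : 0 <= t <= 1 -> clamp t = t.
Proof. by move=> /andP[t0 t1]; rewrite /clamp min_r // max_r. Qed.

Lemma mix01 t x p i :
  0 <= (1 - clamp t) * crd x i + clamp t * crd p i <= 1.
Proof.
have /andP[t0 t1] := clamp01 t.
have /andP[x0 x1] := coord01 (x : point R o) i.
have /andP[p0 p1] := coord01 (p : point R o) i.
rewrite /crd; apply/andP; split; nra.
Qed.

Lemma mix_fin t x p :
  finite_set [set i | (1 - clamp t) * crd x i + clamp t * crd p i != (o i)%:R].
Proof.
apply: (@sub_finite_set _ _
  ([set i | crd x i != (o i)%:R] `|` [set i | crd p i != (o i)%:R])).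
  move=> i /= ne; apply/orP; rewrite -negb_and; apply: contraNN ne.
  by move=> /andP[/eqP -> /eqP ->]; rewrite -mulrDl subrK mul1r.
by rewrite finite_setU; split; exact: coord_fin.
Qed.

(** The straight-line contraction to p; clamping t makes it total. *)
Definition mix t x p : points X := Point (mix01 t x p) (mix_fin t x p).

Lemma mixE t x p i :
  crd (mix t x p) i = (1 - clamp t) * crd x i + clamp t * crd p i.
Proof. by []. Qed.

Lemma mix0 x p : mix 0 x p = x.
Proof.
by apply: point_eq => i /=; rewrite clampE ?lexx ?ler01 // subr0 mul1r mul0r addr0.
Qed.

Lemma mix1 x p : mix 1 x p = p.
Proof.
by apply: point_eq => i /=; rewrite clampE ?lexx ?ler01 // subrr mul1r mul0r add0r.
Qed.

Lemma mix_same t x : mix t x x = x.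
Proof. by apply: point_eq => i; rewrite [LHS]mixE /crd; ring. Qed.

Lemma l2_scale (c : R) (x y x' y' : I -> R) : 0 <= c ->
  (forall i, x' i - y' i = c * (x i - y i)) -> l2 x' y' = c * l2 x y.
Proof.
move=> c0 E; rewrite -[c in RHS]ger0_norm // -sqrtr_sqr /l2 -sqrtrM ?sqr_ge0 //.
congr Num.sqrt; rewrite /sqd mulr_fsumr.
by apply: eq_fsbigr => i _; rewrite E exprMn.
Qed.

Lemma l2_mixl t x y p :
  l2 (crd (mix t x p)) (crd (mix t y p)) = (1 - clamp t) * l2 (crd x) (crd y).
Proof.
apply: l2_scale; first by have /andP[_] := clamp01 t; rewrite subr_ge0.
by move=> i; rewrite !mixE; ring.
Qed.

Lemma l2_mixt t r x p : 0 <= t <= 1 -> 0 <= r <= 1 ->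
  l2 (crd (mix t x p)) (crd (mix r x p)) = `|t - r| * l2 (crd x) (crd p).
Proof.
move=> t01 r01; have [tr|/ltW rt] := lerP t r.
  apply: l2_scale => [|i]; first by rewrite subr_ge0.
  by rewrite !mixE !clampE //; ring.
rewrite l2C; apply: l2_scale => [|i]; first by rewrite subr_ge0.
by rewrite !mixE !clampE //; ring.
Qed.

(** Moving first the time and then the point, the distance of mix t x p and
    mix r y p is at most |t - r| d(x, p) + d(x, y). *)
Lemma mix_cvg (T : Type) (F : set_system T) {FF : Filter F}
    (f : T -> points X) (g : T -> R) x (t : R) p :
  0 <= t <= 1 -> (\forall s \near F, 0 <= g s <= 1) ->
  f @ F --> x -> g @ F --> t -> (fun s => mix (g s) (f s) p) @ F --> mix t x p.
Proof.
move=> t01 g01 fx gt; apply/cvg_ballP => e e0.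
pose C := l2 (crd x) (crd p) + 1.
have C0 : 0 < C by rewrite ltr_pwDr // l2_ge0.
have e2 : 0 < e / 2 by rewrite divr_gt0.
have eC : 0 < e / 2 / C by rewrite divr_gt0.
near=> s; apply/ball_l2.
have fs : l2 (crd x) (crd (f s)) < e / 2.
  by apply/ball_l2; near: s; move/cvg_ballP: fx; apply.
have gs : `|t - g s| < e / 2 / C.
  by near: s; move/cvgrPdist_lt: gt; apply.
have gs01 : 0 <= g s <= 1 by near: s.
apply: (le_lt_trans (l2_triangle (y := crd (mix (g s) x p)) _ _)).
- exact: point_diff.
- exact: point_diff.
rewrite l2_mixt // l2_mixl clampE // [e](_ : _ = e / 2 + e / 2); last by field.
rewrite ltr_leD //.
  apply: (@le_lt_trans _ _ (`|t - g s| * C)).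
    by rewrite ler_wpM2l // lerDl ler01.
  by rewrite -ltr_pdivlMr.
apply: (le_trans _ (ltW fs)); rewrite ler_piMl ?l2_ge0 //.
by case/andP: gs01 => ? _; rewrite lerBlDr lerDl.
Unshelve. all: by end_near.
Qed.

(** Segments join any two points, and the straight-line homotopy contracts a
    loop to its base point while fixing that point. *)
Lemma infinite_cube_simply_connected : simply_connected R (points X).
Proof.
split=> [x y|f cf f01].
  exists (fun t => mix t x y); split; [|exact: mix0|exact: mix1].
  apply/subspace_continuousP => t /=; rewrite in_itv /= => t01.
  apply: mix_cvg => //; last 2 first.
  - exact: cvg_cst.
  - exact: cvg_within.
  by apply: filterS (near_withinT _ _) => s; rewrite /= in_itv.
move/subspace_continuousP: cf => cf.
exists (fun q => mix q.2 (f q.1) (f 0)); split; last first.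
  move=> s _ /=; rewrite mix0 mix1 -f01; split=> //; exact: mix_same.
apply/subspace_continuousP => -[s t] /= [s01 t01].
apply: mix_cvg.
- by move: t01; rewrite /= in_itv.
- by apply: filterS (near_withinT _ _) => -[s' t'] /= [_]; rewrite in_itv.
- apply: (@cvg_comp _ _ _ fst f _ (within `[0, 1] (nbhs s))); last exact: cf.
  have : (@fst R R) @ nbhs (s, t) --> s by exact: cvg_fst.
  move=> sP P nP; have {}nP :
      nbhs (s, t) [set q | (`[0, 1]%classic : set R) q.1 -> P q.1].
    exact: (sP _ nP).
  suff : nbhs (s, t) [set q | (`[0, 1] `*` `[0, 1]) q -> P q.1] by [].
  by apply: filterS nP => -[s' t'] /= h [/h].
- by apply: cvg_within_filter; exact: cvg_snd.
Qed.
End InfiniteCubeMetric.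

(** * Links: every finite set of edges at a vertex spans a cube *)

Section InfiniteCubeLinks.
Variables (R : realType) (I : choiceType) (o : I -> bool).

Local Notation X := (infinite_cube R o).
Implicit Types (x p : points X) (b : I -> bool) (D : set I).

(** The face with set of directions D through the vertex b. *)
Definition box D b : set (points X) :=
  [set x | forall i, ~ D i -> crd x i = (b i)%:R].

Lemma box_change D b b' : (forall i, ~ D i -> b i = b' i) -> box D b = box D b'.
Proof.
move=> bb'; apply/seteqP.
by split=> x xb i Di; [rewrite -bb' // xb | rewrite bb' // xb].
Qed.

Lemma cell_box k (A : set (points X)) : cell k A ->
  exists s b, [/\ uniq s, size s = k, finite_set [set i | b i != o i] &
    A = box [set` s] b].
Proof.
move=> [l [f [<- ->]]].
pose s := [seq @dir _ _ l j | j <- enum [pred j | f j == None]].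
pose b i := if [pick j | @dir _ _ l j == i] is Some j
  then odflt false (f j) else base l i.
have b_dir j c : f j = Some c -> b (dir j) = c.
  rewrite /b; case: pickP => [j' /eqP /(@dir_inj _ _ l) -> -> //|/(_ j)].
  by rewrite eqxx.
have b_off i : ~~ along l i -> b i = base l i.
  move=> /existsPn li; rewrite /b; case: pickP => // j dj.
  by have := li j; rewrite dj.
have sP j : dir j \in s = (f j == None).
  by rewrite mem_map; [rewrite mem_enum | exact: dir_inj].
exists s, b; split.
- by rewrite map_inj_uniq ?enum_uniq //; exact: dir_inj.
- by rewrite size_map -cardE.
- apply: (@sub_finite_set _ _
    ([set i | along l i] `|` [set i | base l i != o i])).
    move=> i /=; have [li _|/b_off ->] := boolP (along l i); first by left.
    by right.
  by rewrite finite_setU; split; [exact: finite_along | exact: base_fin].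
apply/seteqP; split=> [_ [u [cu uf] <-] i /negP is_|x xb].
  rewrite /crd to_pointE //.
  have [/existsP[j /eqP ji]|li] := boolP (along l i); last first.
    by rewrite ext_off // b_off.
  move: is_; rewrite -ji sP ext_dir; case E: (f j) => [c|//] _.
  by rewrite (uf _ _ E) (b_dir _ _ E).
have xl i : ~~ along l i -> x i = (base l i)%:R.
  move=> li; rewrite -b_off //; apply: xb => /mapP[j _ ij].
  by move: li; rewrite ij along_dir.
have [cx xE] := to_point_restr xl; exists (restr l x) => //; split=> // j c E.
by rewrite mxE -(b_dir _ _ E); apply: xb => /=; rewrite sP E.
Qed.

Lemma box_cell (s : seq I) b : uniq s -> finite_set [set i | b i != o i] ->
  cell (size s) (box [set` s] b).
Proof.
move=> us bf; pose l := spanned us bf; exists l, (fun=> None); split.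
  by rewrite /face_dim (eq_card (_ : _ =i predT)) ?card_ord // => i; rewrite inE.
apply/seteqP; split=> [x xb|_ [u [cu _] <-] i /= is_].
  have xl i : ~~ along l i -> x i = (base l i)%:R.
    by rewrite along_spanned => /negP /xb.
  by have [cx xE] := to_point_restr xl; exists (restr l x).
rewrite /crd to_pointE // ext_off // along_spanned; exact/negP.
Qed.

Lemma flip_fin b i : finite_set [set j | b j != o j] ->
  finite_set [set j | (if j == i then ~~ b j else b j) != o j].
Proof.
move=> bf; apply: (@sub_finite_set _ _ ([set j | b j != o j] `|` [set i])).
  by move=> j /=; have [->|_] := eqVneq j i; [right|left].
by rewrite finite_setU; split.
Qed.

(** If i is not in D, the other end of the edge in direction i leaves the box. *)
Lemma edge_in_box i D b : finite_set [set j | b j != o j] ->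
  (box [set i] b `<=` box D b) <-> D i.
Proof.
move=> bf; split=> [sub|Di x xi j Dj]; last first.
  by apply: xi => /= ji; apply: Dj; rewrite ji.
apply: contrapT => Di.
have : box [set i] b (vertex R (flip_fin i bf)).
  by move=> j /= /eqP /negbTE ji; rewrite /crd /= ji.
move=> /sub /(_ i Di); rewrite /crd /= eqxx => /eqP.
by rewrite eqr_nat; case: (b i).
Qed.

Lemma edge_inj i j b : finite_set [set k | b k != o k] ->
  box [set i] b = box [set j] b -> i = j.
Proof. by move=> bf ij; apply/(edge_in_box i [set j] bf); rewrite ij. Qed.

Lemma edge_cell i b : finite_set [set k | b k != o k] ->
  cell 1 (box [set i] b).
Proof.
move=> bf; have := @box_cell [:: i] b erefl bf.
by rewrite (_ : [set` [:: i]] = [set i]) //; apply/seteqP; split=> j;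
  rewrite /= inE => /eqP.
Qed.

(** The edges at the vertex b correspond to the indices, and the edges in the
    directions of any finite set D are exactly those of the cube box D b: the
    link is a full simplex. The hypothesis on pairs serves, with both members
    equal, to know that the elements of S are edges at the vertex. *)
Lemma infinite_cube_flag p : cell 0 [set p] -> flag (link p).
Proof.
move=> /cell_box[s0 [b [_ s0E bf pE]]] S Sfin Spair.
have {s0E} : s0 = [::] by case: s0 s0E {pE}.
move=> s00; subst s0.
have pb i : crd p i = (b i)%:R.
  by have : [set p] p by []; rewrite pE => /(_ i); apply.
have edgeP E : cell 1 E -> E p -> exists i, E = box [set i] b.
  move=> /cell_box[s [b' [_ s1 _ ->]]] pb'.
  case: s s1 pb' => [|i [|? ?]] //= _ pb'.
  have iE : [set` [:: i]] = [set i].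
    by apply/seteqP; split=> j; rewrite /= inE => /eqP.
  rewrite iE in pb' *.
  exists i; apply: box_change => j ji; apply/eqP.
  by move/eqP: (pb' j ji); rewrite pb eqr_nat; case: (b j) (b' j) => -[].
have box_p D : box D b p by move=> i _; exact: pb.
have Sedge E : S E -> exists i, E = box [set i] b.
  move=> SE; have [k [C [_ _ CE]]] := Spair E E SE SE.
  have : [set E; E] E by left.
  by rewrite CE => -[cE Ep _]; exact: edgeP.
have : finite_set [set i | S (box [set i] b)].
  apply: (@finite_preimage _ _ S (fun i => box [set i] b)) => //.
  by move=> i j _ _; exact: edge_inj.
move=> /finite_support_seq[s us sP]; exists (size s), (box [set` s] b).
split; [exact: box_cell | exact: box_p | apply/seteqP; split=> E].
  move=> SE; have [i Ei] := Sedge _ SE; split.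
  - by rewrite Ei; exact: edge_cell.
  - by rewrite Ei; exact: box_p.
  - by rewrite Ei; apply/edge_in_box => //; apply/sP; rewrite /= -Ei.
move=> [cE /(edgeP _ cE)[i Ei]]; rewrite {}Ei in cE *.
by move=> /(edge_in_box _ _ bf) /sP.
Qed.

Lemma infinite_cube_cat0 : cat0 X.
Proof.
split; first exact: infinite_cube_simply_connected.
exact: infinite_cube_flag.
Qed.

Lemma infinite_cube_infinite : infinite_set [set: I] -> infinite_complex X.
Proof.
move=> Iinf cfin; apply: Iinf.
have o_fin := differ_refl_fin o.
apply: (@sub_finite_set _ _
  ((fun i => box [set i] o) @^-1` [set A | exists k, cell k A])).
  by move=> i _; exists 1%N; exact: edge_cell.
by apply: finite_preimage cfin => i j _ _; exact: edge_inj.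
Qed.

End InfiniteCubeLinks.

(** * The action of a group that moves o at finitely many indices *)

Section PermutationAction.
Variables (G : groupType) (I : choiceType) (rho : G -> I -> I).
Hypothesis rho1 : forall i, rho 1%g i = i.
Hypothesis rhoM : forall g h i, rho (g * h)%g i = rho g (rho h i).

Lemma rhoK g : cancel (rho g) (rho g^-1%g).
Proof. by move=> i; rewrite -rhoM mulVg rho1. Qed.

Lemma rhoVK g : cancel (rho g^-1%g) (rho g).
Proof. by move=> i; rewrite -rhoM mulgV rho1. Qed.

Lemma rho_inj g : injective (rho g). Proof. exact: can_inj (rhoK g). Qed.

Variable o : I -> bool.

(** The symmetric difference of the subset o of I and of its translate by g. *)
Definition displaced g : set I := [set i | o (rho g^-1%g i) != o i].

Hypothesis displaced_fin : forall g, finite_set (displaced g).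

Lemma in_displaced g i :
  (i \in fset_set (displaced g)) = (o (rho g^-1%g i) != o i).
Proof.
by rewrite in_fset_set //; apply/idP/idP => [/set_mem//|ne]; exact/mem_set.
Qed.

Section CubicalAction.
Variable R : realType.

Local Notation X := (infinite_cube R o).
Implicit Types x y : points X.

Lemma move01 g x i : 0 <= crd x (rho g^-1%g i) <= 1.
Proof. exact: coord01. Qed.

Lemma move_fin g x : finite_set [set i | crd x (rho g^-1%g i) != (o i)%:R].
Proof.
apply: (@sub_finite_set _ _
  (rho g^-1%g @^-1` [set i | crd x i != (o i)%:R] `|` displaced g)).
  move=> i /= ne; apply/orP; rewrite -negb_and; apply: contraNN ne.
  by move=> /andP[/eqP -> /eqP ->].
rewrite finite_setU; split; last exact: displaced_fin.
by apply: finite_preimage; [move=> i j _ _; exact: rho_inj | exact: coord_fin].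
Qed.

(** The translate of x by g; it is almost equal to o since g displaces o at
    finitely many indices only. *)
Definition move_point g x : points X := Point (move01 g x) (move_fin g x).

Lemma crd_move g x i : crd (move_point g x) i = crd x (rho g^-1%g i).
Proof. by []. Qed.

Lemma move1 x : move_point 1%g x = x.
Proof. by apply: point_eq => i; rewrite [LHS]crd_move invg1 rho1. Qed.

Lemma moveM g h x : move_point (g * h)%g x = move_point g (move_point h x).
Proof. by apply: point_eq => i; rewrite [LHS]crd_move invgM rhoM. Qed.

Lemma move_label_fin g (l : label o) :
  finite_set [set i | base l (rho g^-1%g i) != o i].
Proof.
apply: (@sub_finite_set _ _
  (rho g^-1%g @^-1` [set i | base l i != o i] `|` displaced g)).
  move=> i /= ne; apply/orP; rewrite -negb_and; apply: contraNN ne.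
  by move=> /andP[/eqP -> /eqP ->].
rewrite finite_setU; split; last exact: displaced_fin.
by apply: finite_preimage; [move=> i j _ _; exact: rho_inj | exact: base_fin].
Qed.

Definition move_label g l : label o :=
  Label (inj_comp (rho_inj (g := g)) (@dir_inj _ _ l)) (move_label_fin g l).

Lemma ext_move_label g l (u : 'rV[R]_(dim l)) i :
  @ext R I o (move_label g l) u i = ext u (rho g^-1%g i).
Proof.
have [/existsP[j /eqP <-]|li] := boolP (along (move_label g l) i).
  by rewrite ext_dir /= rhoK ext_dir.
rewrite !ext_off //; apply: contraNN li => /existsP[j /eqP ji].
by apply/existsP; exists j => /=; rewrite ji rhoVK.
Qed.

Lemma move_cubical g : cubical (move_point g).
Proof.
move=> l; exists (move_label g l), (fun=> None), id; split.
  by split=> //; rewrite image_id; apply/seteqP; split=> u // -[].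
move=> u cu; apply: point_eq => i.
rewrite [LHS]crd_move /crd /= !to_pointE //.
by rewrite ext_move_label.
Qed.

Lemma move_cubical_action : cubical_action move_point.
Proof.
split=> [g||]; [|exact: move1|exact: moveM].
exists (move_point g^-1%g); split; try exact: move_cubical.
- by move=> x; rewrite -moveM mulVg move1.
- by move=> x; rewrite -moveM mulgV move1.
Qed.

Lemma l2_move g x y :
  l2 (crd (move_point g x)) (crd (move_point g y)) = l2 (crd x) (crd y).
Proof.
have [s us sP] := finite_support_seq (point_diff (x : point R o) y).
have eqs i : i \notin s -> crd x i = crd y i.
  by move=> /negP is_; apply/eqP/negPn/negP => /sP.
congr Num.sqrt; rewrite [RHS](sqdE us) // (@sqdE _ _ (map (rho g) s)).
- rewrite big_map; apply: eq_bigr => i _.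
  by rewrite !crd_move rhoK.
- by rewrite map_inj_uniq //; exact: rho_inj.
- move=> i is_; rewrite !crd_move; apply: eqs; apply: contraNN is_ => is_.
  by apply/mapP; exists (rho g^-1%g i) => //; rewrite rhoVK.
Qed.

(** The squared distance from the origin to its translate by g is the number of
    displaced indices, and the orbit of any other point stays within a bounded
    distance of the orbit of the origin. *)
Lemma unbounded_displacement_orbit :
  (forall N, exists g, (N <= #|` fset_set (displaced g)|)%N) ->
  without_bounded_orbit move_point.
Proof.
move=> unb x [M orbM].
pose p : points X := origin R o.
pose C := l2 (crd x) (crd p).
have dispM g : (#|` fset_set (displaced g)|)%:R <= (C + (M + C)) ^+ 2.
  have <- : l2 (crd (move_point g p)) (crd p) ^+ 2 =
      #|` fset_set (displaced g)|%:R.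
    rewrite sqr_l2; apply: (@l2_bool_card _ _ (o \o rho g^-1%g)) => i.
    exact: in_displaced.
  rewrite lerXn2r ?nnegrE ?l2_ge0 //.
    rewrite !addr_ge0 ?l2_ge0 //.
    have := orbM _ _ (ex_intro2 _ _ g Logic.I erefl) (ex_intro2 _ _ g Logic.I erefl).
    by rewrite cc_distE lee_fin; apply: le_trans; exact: l2_ge0.
  apply: (le_trans (l2_triangle (y := crd (move_point g x)) _ _)).
  - exact: point_diff.
  - exact: point_diff.
  rewrite l2_move l2C lerD2l.
  apply: (le_trans (l2_triangle (y := crd x) _ _)).
  - exact: point_diff.
  - exact: point_diff.
  rewrite lerD2r -lee_fin -cc_distE; apply: orbM; first by exists g.
  by exists 1%g => //; exact: move1.
have [g] := unb (Num.bound ((C + (M + C)) ^+ 2)).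
rewrite -(ler_nat R) => /le_trans/(_ (dispM g)).
apply/negP; rewrite -ltNge; apply: le_lt_trans (archi_boundP _); last exact: sqr_ge0.
exact: lexx.
Qed.
End CubicalAction.

(** * Large displacements *)

Section UnboundedDisplacement.

Hypothesis infinite_orbits :
  forall i (E : seq I), exists g, rho g i \notin E.

(** Induction on E. Since orbits are infinite, finitely many translates of E' have
    an empty intersection: E' itself, and for each x in E' a translate by (c x)^-1
    avoiding x. If h moves E off all of these translates, then h e avoids one
    of them, and composing h with the corresponding c x does what is wanted. *)
Lemma neumann_separation (E E' : seq I) :
  exists h, forall e, e \in E -> rho h e \notin E'.
Proof.
elim: E E' => [|e E IH] E'; first by exists 1%g.
have /choice[c cP] : forall x, exists g, rho g x \notin E'.
  by move=> x; exact: infinite_orbits.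
have [h hP] := IH (E' ++ [seq rho (c x)^-1%g y | x <- E', y <- E']).
have [he|he] := boolP (rho h e \in E'); last first.
  exists h => f; rewrite inE => /predU1P[-> //|/hP].
  by rewrite mem_cat negb_or => /andP[].
exists (c (rho h e) * h)%g => f; rewrite rhoM inE => /predU1P[-> //|/hP].
rewrite mem_cat negb_or => /andP[_]; apply: contraNN => fE.
apply/allpairsP; exists (rho h e, rho (c (rho h e)) (rho h f)); split=> //=.
by rewrite rhoK.
Qed.

(** A discrete form of the fixed point theorem for bounded orbits. Write M for
    the subset o of I, and d for the cardinality of a symmetric difference.
    Suppose that d(M, gM) is bounded and take g0 reaching its maximum, with F the
    symmetric difference of M and g0 M. If h moves F off itself, then the four
    distances between {M, g0 M} and {h M, h g0 M} are at most |F|; the indices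
    in F and in hF alone contribute 4|F| to their sum, because the two sets of
    a pair are complementary there. Hence M and hM agree outside of F and hF.
    Comparing M with hM and htM, for an h that moves everything relevant far
    away, M and tM agree outside of F and tF for every t. This is absurd when
    t maps an element outside of M and F to an element of M outside of F. *)
Lemma displacement_unbounded :
  (forall F : seq I, exists x y t,
     [/\ o x, ~~ o y, x \notin F, y \notin F & rho t y = x]) ->
  forall N, exists g, (N <= #|` fset_set (displaced g)|)%N.
Proof.
move=> cross N; apply: contrapT => /forallNP small.
pose card g := #|` fset_set (displaced g)|.
have [g0 g0max] : exists g0, forall g, (card g <= card g0)%N.
  have Pex : exists n, `[< exists g, card g = n >].
    by exists (card 1%g); apply/asboolP; exists 1%g.
  have Pub n : `[< exists g, card g = n >] -> (n <= N)%N.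
    by move=> /asboolP[g <-]; rewrite leqNgt; apply/negP => /ltnW /small.
  have [n /asboolP[g0 <-] gmax] := ex_maxnP Pex Pub.
  by exists g0 => g; apply: gmax; apply/asboolP; exists g.
pose F : seq I := fset_set (displaced g0).
have FE i : (i \in F) = (o (rho g0^-1%g i) != o i) by exact: in_displaced.
have dist_max (T : seq I) g h : uniq T ->
    (\sum_(i <- T) (o (rho g^-1%g i) != o (rho h^-1%g i)) <= card g0)%N.
  move=> uT; apply: leq_trans (g0max (h^-1 * g)%g).
  rewrite -big_mkcond /= sum1_count -size_filter.
  rewrite -(size_map (rho h^-1%g)); apply: uniq_leq_size.
    by rewrite map_inj_uniq ?filter_uniq //; exact: rho_inj.
  move=> _ /mapP[i + ->]; rewrite mem_filter => /andP[ne _].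
  by rewrite in_displaced invgM invgK rhoM rhoVK.
have dist_g0 (T : seq I) h : (forall i, i \in F -> rho h i \in T) ->
    (card g0 <= \sum_(i <- T) (o (rho h^-1%g i) != o (rho (h * g0)^-1%g i)))%N.
  move=> FT; rewrite -big_mkcond /= sum1_count -size_filter.
  rewrite /card -(size_map (rho h)); apply: uniq_leq_size.
    by rewrite map_inj_uniq ?fset_uniq //; exact: rho_inj.
  move=> _ /mapP[i iF ->]; rewrite mem_filter FT // andbT.
  by rewrite invgM rhoM rhoK eq_sym -FE.
have far h : (forall f, f \in F -> rho h f \notin F) ->
    forall i, o i != o (rho h^-1%g i) -> i \in F \/ rho h^-1%g i \in F.
  move=> hF i0 ne0; apply: contrapT => /not_orP[/negP i0F /negP hi0F].
  pose T := undup (i0 :: F ++ [seq rho h i | i <- F]).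
  have uT : uniq T by exact: undup_uniq.
  have F1 : forall i, i \in F -> rho 1%g i \in T.
    by move=> i iF; rewrite rho1 mem_undup inE mem_cat iF orbT.
  have F2 : forall i, i \in F -> rho h i \in T.
    by move=> i iF; rewrite mem_undup inE mem_cat (map_f _ iF) !orbT.
  pose dist g h := (\sum_(i <- T) (o (rho g^-1%g i) != o (rho h^-1%g i)))%N.
  (* The inequality holds index by index, and i0 makes it strict. *)
  have quad : (dist 1%g g0 + dist 1%g g0 + (dist h (h * g0)%g + dist h (h * g0)%g)
      < dist 1%g h + dist 1%g (h * g0)%g + (dist g0 h + dist g0 (h * g0)%g))%N.
    have i0T : (1 <= \sum_(i <- T) (i == i0))%N.
      by rewrite -big_mkcond /= sum1_count -has_count has_pred1 mem_undup mem_head.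
    rewrite -addn1; apply: leq_trans (leq_add (leqnn _) i0T) _.
    rewrite /dist -!big_split /=; apply: leq_sum => i _.
    have disj : ~~ ((i \in F) && (rho h^-1%g i \in F)).
      by apply/negP => /andP[iF /hF]; rewrite rhoVK iF.
    move: disj; rewrite !FE !invgM !rhoM invg1 !rho1.
    have [ii0|_] := eqVneq i i0.
      move: i0F hi0F ne0; rewrite -ii0 !FE.
      by do 4 case: (o _).
    by do 4 case: (o _).
  have low1 : (card g0 <= dist 1%g g0)%N by have := dist_g0 T 1%g F1; rewrite mul1g.
  have low2 : (card g0 <= dist h (h * g0)%g)%N by exact: dist_g0.
  have up g k : (dist g k <= card g0)%N by exact: dist_max.
  have := up 1%g h; have := up 1%g (h * g0)%g.
  have := up g0 h; have := up g0 (h * g0)%g.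
  by move: quad low1 low2; do ! move: (dist _ _) => ?; lia.
have near_ t i : o i != o (rho t^-1%g i) -> i \in F \/ rho t^-1%g i \in F.
  move=> ne.
  (* hM and htM differ at h i, so that one of them differs from M there. *)
  have [h hE] := neumann_separation
    (i :: F ++ [seq rho t f | f <- F]) (i :: F ++ [seq rho t f | f <- F]).
  have notF f : f \in i :: F ++ [seq rho t f | f <- F] -> rho h f \notin F.
    by move=> /hE; rewrite inE mem_cat !negb_or => /and3P[].
  have hF : forall f, f \in F -> rho h f \notin F.
    by move=> f fF; apply: notF; rewrite inE mem_cat fF orbT.
  have htF : forall f, f \in F -> rho (h * t)%g f \notin F.
    by move=> f fF; rewrite rhoM; apply: notF; rewrite inE mem_cat map_f ?orbT.
  have hi : rho h i \notin F by apply: notF; rewrite mem_head.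
  have [E|neh] := eqVneq (o (rho h i)) (o i); last first.
    by have := far h hF (rho h i); rewrite rhoK (negbTE hi) => /(_ neh)[//|]; left.
  have := far (h * t)%g htF (rho h i).
  by rewrite invgM rhoM rhoK E (negbTE hi) => /(_ ne)[//|]; right.
have [x [y [t [ox oy xF yF yx]]]] := cross F.
have := near_ t x; rewrite -[in rho _ x]yx rhoK ox (negbTE oy).
by rewrite (negbTE xF) (negbTE yF) => /(_ isT)[].
Qed.
End UnboundedDisplacement.
End PermutationAction.

(** * Tree automorphisms acting on rays *)

Section BoundaryAction.
Implicit Types (xi eta : nat -> bool) (g h : tree_aut).

(** Automorphisms fixing the root preserve levels, hence prefixes: the image of a
    child of x cannot be the parent of the image of x, which is the image of the
    parent of x. *)
Lemma taut_rcons g x e : exists e', g (rcons x e) = rcons (g x) e'.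
Proof.
elim/last_ind: x e => [|x e0 IH] e.
  have [_ /(_ (or_introl (ex_intro _ e erefl)))] := taut_adj g [::] (rcons [::] e).
  by case=> // -[b]; rewrite taut_root; case: (g _).
have [_ /(_ (or_introl (ex_intro _ e erefl)))] :=
  taut_adj g (rcons x e0) (rcons (rcons x e0) e).
case=> // -[b]; have [e' ->] := IH e0 => /rcons_inj[/(can_inj (@tautK g)) xE _].
by have := congr1 size xE; rewrite !size_rcons; lia.
Qed.

Definition ray_act g xi : nat -> bool := fun n =>
  nth false (g (mkseq xi n.+1)) n.

Lemma mkseq_ray_act g xi n : mkseq (ray_act g xi) n = g (mkseq xi n).
Proof.
elim: n => [|n IH]; first by rewrite /mkseq /= taut_root.
rewrite mkseqS IH /ray_act mkseqS.
have [e' ->] := taut_rcons g (mkseq xi n) (xi n).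
by rewrite nth_rcons -IH size_mkseq ltnn eqxx.
Qed.

Lemma ray_eq xi eta : (forall n, mkseq xi n = mkseq eta n) -> xi = eta.
Proof.
move=> E; apply/funext => n; have := congr1 (nth false ^~ n) (E n.+1).
by rewrite !nth_mkseq.
Qed.

Lemma ray_act1 xi : ray_act 1%g xi = xi.
Proof. by apply: ray_eq => n; rewrite mkseq_ray_act. Qed.

Lemma ray_actM g h xi : ray_act (g * h)%g xi = ray_act g (ray_act h xi).
Proof. by apply: ray_eq => n; rewrite !mkseq_ray_act. Qed.

Definition ray_cons (e : bool) xi : nat -> bool :=
  fun n => if n is m.+1 then xi m else e.

Lemma ray_consE xi : xi = ray_cons (xi 0%N) (fun n => xi n.+1).
Proof. by apply/funext => -[]. Qed.

Lemma mkseq_ray_cons e xi n : mkseq (ray_cons e xi) n.+1 = e :: mkseq xi n.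
Proof.
apply: (@eq_from_nth _ false); rewrite /= ?size_map ?size_iota // => -[|i] //=.
rewrite ltnS => i_n; rewrite !(nth_map 0%N) ?size_iota //.
by rewrite !nth_iota.
Qed.

Lemma ray_act_a e xi : ray_act gen_a (ray_cons e xi) = ray_cons (~~ e) xi.
Proof.
apply: ray_eq => -[|n] //.
by rewrite mkseq_ray_act !mkseq_ray_cons.
Qed.

Lemma ray_act_spinal1 k w xi : ray_act (gen_spinal k w) (ray_cons true xi) =
  ray_cons true (ray_act (gen_spinal k (shift_seq w)) xi).
Proof.
apply: ray_eq => -[|n] //.
by rewrite mkseq_ray_act !mkseq_ray_cons /= mkseq_ray_act.
Qed.

Lemma ray_act_spinal0 k w xi : ray_act (gen_spinal k w) (ray_cons false xi) =
  ray_cons false (if w 0%N == k :> nat then xi else ray_act gen_a xi).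
Proof.
apply: ray_eq => -[|n] //.
rewrite mkseq_ray_act !mkseq_ray_cons /=.
by case: ifP => // _; rewrite mkseq_ray_act.
Qed.

Definition ray_flip p xi : nat -> bool :=
  fun i => if i == p then ~~ xi i else xi i.

Lemma ray_act_a_flip xi : ray_act gen_a xi = ray_flip 0 xi.
Proof. by rewrite [xi in LHS]ray_consE ray_act_a; apply/funext => -[]. Qed.

(** A spinal generator only sees the first letter 0 of a ray: it may flip the
    letter that follows it. *)
Lemma ray_act_spinal_flip k w xi p :
  (forall i, (i < p)%N -> xi i) -> ~~ xi p ->
  ray_act (gen_spinal k w) xi = xi \/
  ray_act (gen_spinal k w) xi = ray_flip p.+1 xi.
Proof.
elim: p w xi => [|p IH] w xi ones zero; rewrite (ray_consE xi).
  rewrite (negbTE zero) ray_act_spinal0; case: ifP => _; [by left|right].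
  by rewrite ray_act_a_flip; apply/funext => -[].
rewrite (ones 0%N) // ray_act_spinal1.
have [->|->] := IH (shift_seq w) (fun n => xi n.+1) (fun i => ones i.+1) zero.
  by left.
right.
by apply/funext => -[].
Qed.

End BoundaryAction.

(** * A half-line in the Schreier graph of the rays *)

Section HalfLine.
Implicit Types (xi eta : nat -> bool).

Definition last_one xi k := xi k /\ forall j, (k < j)%N -> ~~ xi j.

(** The Schreier graph of the rays cofinal with 000... is a line whose shape
    does not depend on w: a joins e x to (1-e) x, and the spinal generators join
    1^k 0 e x to 1^k 0 (1-e) x. Removing the edge from 000... to 1000... leaves
    two half-lines, and this is the one that contains 1000... *)
Definition half_line xi : bool := `[< exists2 k, ~~ odd k & last_one xi k >].

Lemma ray_flipK p : involutive (ray_flip p).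
Proof.
move=> xi; apply/funext => i; rewrite /ray_flip.
by case: eqP => // _; rewrite negbK.
Qed.

Lemma last_one_flip p k xi : (p < k)%N -> last_one xi k ->
  last_one (ray_flip p xi) k.
Proof.
move=> pk [xk zk]; split=> [|j kj]; rewrite /ray_flip.
  by rewrite gtn_eqF.
by rewrite gtn_eqF ?zk //; exact: ltn_trans pk kj.
Qed.

(** Let p be the position of the first 0 and m that of the last 1, so that m is
    not p. Flipping the letter p+1 changes m only if m = p-1, when m becomes
    m+2, or if m = p+1, when all letters before p are 1 and m becomes m-2. In the
    second case p is odd, so that there is a letter before p. *)
Lemma half_line_spinal k w xi :
  half_line xi -> half_line (ray_act (gen_spinal k w) xi).
Proof.
move=> /asboolP[m em [xm zm]].
have [p zp ones] : exists2 p, ~~ xi p & forall i, (i < p)%N -> xi i.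
  have ex : exists n, ~~ xi n by exists m.+1; exact: zm.
  have [p zp pmin] := ex_minnP ex; exists p => // i ip.
  by apply: contraLR ip => /pmin; rewrite -leqNgt.
have [->|->] := ray_act_spinal_flip k w ones zp; apply/asboolP.
  by exists m.
have [pm|mp|mp] := ltngtP p.+1 m.
- by exists m => //; exact: last_one_flip.
- have mpE : m.+1 = p.
    have [mp1|pm|//] := ltngtP m.+1 p.
      by have := ones _ mp1; rewrite (negbTE (zm _ (ltnSn m))).
    by move: zp; rewrite (_ : p = m) ?xm //; lia.
  exists p.+1; first by rewrite -mpE /= negbK.
  split=> [|j pj]; rewrite /ray_flip; first by rewrite eqxx zm // ltnW // -mpE.
  by rewrite gtn_eqF // zm //; lia.
- case: p zp ones mp => [|p] zp ones mp; first by move: em; rewrite -mp.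
  exists p; first by move: em; rewrite -mp /= negbK.
  split=> [|j pj]; rewrite /ray_flip.
    by rewrite ltn_eqF ?ones //; lia.
  case: eqP => [->|/eqP jp]; first by rewrite negbK mp.
  have [->|jp'] := eqVneq j p.+1; first exact: zp.
  by rewrite zm //; lia.
Qed.

Lemma half_line_spinalE k w xi :
  half_line (ray_act (gen_spinal k w) xi) = half_line xi.
Proof.
apply/idP/idP => [/(half_line_spinal k w)|]; last exact: half_line_spinal.
rewrite -ray_actM (_ : (_ * _)%g = 1%g) ?ray_act1 //.
by apply: tree_autP => x; exact: spinalK.
Qed.

(** The first letter does not matter unless it is the last 1. *)
Lemma half_line_a xi : (exists2 j, (0 < j)%N & xi j) ->
  half_line (ray_act gen_a xi) = half_line xi.
Proof.
rewrite ray_act_a_flip.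
have H eta : (exists2 j, (0 < j)%N & eta j) -> half_line eta ->
    half_line (ray_flip 0 eta).
  move=> [j j0 ej] /asboolP[[|k] ek ok]; last first.
    by apply/asboolP; exists k.+1 => //; exact: last_one_flip.
  by case: ok => _ /(_ j j0); rewrite ej.
move=> [j j0 xj]; apply/idP/idP => [h|]; last by apply: H; exists j.
rewrite -[xi](ray_flipK 0); apply: H h; exists j => //.
by rewrite /ray_flip gtn_eqF.
Qed.

End HalfLine.

(** * The Grigorchuk groups *)

Section Grigorchuk.
Implicit Types (w : nat -> 'I_3) (xi eta : nat -> bool).

Definition grig_act w (g : grigorchuk w) xi := ray_act (val g) xi.

Lemma grig_act1 w xi : @grig_act w 1%g xi = xi.
Proof. exact: ray_act1. Qed.

Lemma grig_actM w (g h : grigorchuk w) xi :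
  grig_act (g * h)%g xi = grig_act g (grig_act h xi).
Proof. exact: ray_actM. Qed.

Lemma grigorchuk_ind w (P : tree_aut -> Prop) :
  P 1%g -> (forall g h, P g -> P h -> P (g * h^-1)%g) ->
  P gen_a -> (forall k, (k < 3)%N -> P (gen_spinal k w)) ->
  forall g : grigorchuk w, P (val g).
Proof.
move=> P1 PM Pa Ps [g /= gen_g].
have := set_mem gen_g => /(_ [set g | P g]); apply; split.
  split=> [|x y]; first exact/mem_set.
  by move=> /set_mem Px /set_mem Py; apply/mem_set; exact: PM.
move=> h [[[->|->]|->]|->] //=; exact: Ps.
Qed.

Lemma in_grigorchuk w g : [set gen_a; gen_b w; gen_c w; gen_d w] g ->
  exists h : grigorchuk w, val h = g.
Proof.
move=> gA.
have gG : g \in generated [set gen_a; gen_b w; gen_c w; gen_d w].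
  by apply/mem_set => S [_]; apply.
by exists (GenSubgroup gG).
Qed.

Lemma in_grigorchuk_a w : exists h : grigorchuk w, val h = gen_a.
Proof. by apply: in_grigorchuk; left; left; left. Qed.

Lemma in_grigorchuk_spinal w k : (k < 3)%N ->
  exists h : grigorchuk w, val h = gen_spinal k w.
Proof.
case: k => [|[|[|//]]] _; apply: in_grigorchuk.
- by right.
- by left; right.
- by left; left; right.
Qed.

Definition same_orbit w xi eta := exists g : grigorchuk w, grig_act g xi = eta.

Lemma same_orbit_refl w xi : same_orbit w xi xi.
Proof. by exists 1%g; exact: grig_act1. Qed.

Lemma same_orbit_sym w xi eta : same_orbit w xi eta -> same_orbit w eta xi.
Proof.
by move=> [g <-]; exists g^-1%g; rewrite -grig_actM mulVg grig_act1.
Qed.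

Lemma same_orbit_trans w eta xi zeta :
  same_orbit w xi eta -> same_orbit w eta zeta -> same_orbit w xi zeta.
Proof. by move=> [g <-] [h <-]; exists (h * g)%g; rewrite grig_actM. Qed.

Lemma same_orbit_a w e xi : same_orbit w (ray_cons e xi) (ray_cons (~~ e) xi).
Proof.
have [h hE] := in_grigorchuk_a w.
by exists h; rewrite /grig_act hE ray_act_a.
Qed.

(** The first level stabilizer of G_w maps onto G_(shift w) at the letter 0: the
    conjugate by a of a spinal generator acts there as its shift, and a suitable
    spinal generator acts there as a. *)
Lemma same_orbit_cons w xi eta : same_orbit (shift_seq w) xi eta ->
  same_orbit w (ray_cons false xi) (ray_cons false eta).
Proof.
move=> [g <-]; rewrite /grig_act.
apply: (grigorchuk_ind (w := shift_seq w) (P := fun g => forall xi,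
  same_orbit w (ray_cons false xi) (ray_cons false (ray_act g xi)))).
- by move=> {}xi; rewrite ray_act1; exact: same_orbit_refl.
- move=> {}g h Pg Ph {}xi; rewrite ray_actM.
  apply: (same_orbit_trans _ (Pg _)); apply: same_orbit_sym.
  by have := Ph (ray_act h^-1%g xi); rewrite -ray_actM mulgV ray_act1.
- move=> {}xi.
  (* Any spinal generator whose index is not the first letter of w acts as a. *)
  pose k := if w 0%N == 2 :> nat then 1%N else 2%N.
  have k3 : (k < 3)%N by rewrite /k; case: ifP.
  have wk : (w 0%N == k :> nat) = false.
    by rewrite /k; case: ifPn => [/eqP ->|/negbTE].
  have [h hE] := in_grigorchuk_spinal w k3.
  by exists h; rewrite /grig_act hE ray_act_spinal0 wk.
- move=> k k3 {}xi.
  apply: same_orbit_trans (same_orbit_a _ _ _) _.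
  apply: same_orbit_trans _ (same_orbit_a _ true _).
  have [h hE] := in_grigorchuk_spinal w k3.
  by exists h; rewrite /grig_act hE ray_act_spinal1.
Qed.

(** Induction on the length of the prefixes, for all w at once: a moves both rays
    to rays starting with 0. *)
Lemma cofinal_same_orbit n w xi eta :
  (forall m, (n <= m)%N -> xi m = eta m) -> same_orbit w xi eta.
Proof.
elim: n w xi eta => [|n IH] w xi eta tails.
  suff -> : xi = eta by exact: same_orbit_refl.
  by apply/funext => m; exact: tails.
have to0 zeta : same_orbit w zeta (ray_cons false (fun m => zeta m.+1)).
  rewrite [X in same_orbit _ X]ray_consE; case: (zeta 0%N).
    exact: same_orbit_a.
  exact: same_orbit_refl.
apply: same_orbit_trans (to0 xi) _.
apply: same_orbit_trans _ (same_orbit_sym (to0 eta)).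
by apply/same_orbit_cons/IH => m nm; exact: tails.
Qed.

Definition one_at k : nat -> bool := fun i => i == k.

Lemma last_one_at k : last_one (one_at k) k.
Proof. by split=> [|j kj]; rewrite /one_at ?eqxx // gtn_eqF. Qed.

Lemma one_at_inj : injective one_at.
Proof.
by move=> j k /(congr1 (fun xi => xi j)); rewrite /one_at eqxx => /esym/eqP.
Qed.

Lemma half_line_one_at k : half_line (one_at k) = ~~ odd k.
Proof.
apply/asboolP/idP => [[j ej [/eqP <- //]]|ek].
by exists k => //; exact: last_one_at.
Qed.

Lemma leaves_finite (f : nat -> (nat -> bool)) (E : seq (nat -> bool)) :
  injective f -> exists k, f k \notin E.
Proof.
move=> fi; apply: contrapT => /forallNP fE.
have : (size (map f (iota 0 (size E).+1)) <= size E)%N.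
  apply: uniq_leq_size; first by rewrite map_inj_uniq ?iota_uniq.
  by move=> _ /mapP[k _ ->]; apply/negPn/negP; exact: fE.
by rewrite size_map size_iota ltnn.
Qed.

Lemma grig_infinite_orbits w xi (E : seq (nat -> bool)) :
  exists g : grigorchuk w, grig_act g xi \notin E.
Proof.
have finj : injective (ray_flip ^~ xi).
  move=> j k /(congr1 (fun zeta => zeta j)); rewrite /ray_flip eqxx.
  by case: eqP => // _; case: (xi j).
have [k kE] := leaves_finite E finj.
have [g gE] : same_orbit w xi (ray_flip k xi).
  apply: (@cofinal_same_orbit k.+1) => m km.
  by rewrite /ray_flip gtn_eqF.
by exists g; rewrite gE.
Qed.

(** The spinal generators preserve the half-line, and a displaces only the rays
    000... and 1000... *)
Lemma grig_displaced_fin w (g : grigorchuk w) :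
  finite_set (displaced (@grig_act w) half_line g).
Proof.
pose disp (g : tree_aut) := [set xi | half_line (ray_act g xi) != half_line xi].
suff : finite_set (disp (val g^-1%g)) by [].
apply: (grigorchuk_ind (P := fun g => finite_set (disp g))) => [|{}g h fg fh||k _].
- rewrite (_ : disp _ = set0) //; apply/seteqP; split => xi //=.
  by rewrite /disp /= ray_act1 eqxx.
- apply: (@sub_finite_set _ _ (ray_act h^-1%g @^-1` (disp g `|` disp h))).
    move=> xi; rewrite /disp /= => ne; apply/orP; rewrite -negb_and.
    apply: contraNN ne; rewrite -!ray_actM mulgV ray_act1.
    by move=> /andP[/eqP -> /eqP <-].
  apply: finite_preimage; last by rewrite finite_setU.
  move=> xi eta _ _; apply: (can_inj (g := ray_act h)) => zeta.
  by rewrite -ray_actM mulgV ray_act1.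
- apply: (@sub_finite_set _ _
    [set ray_cons true (fun=> false); ray_cons false (fun=> false)]).
    move=> xi; rewrite /disp /= => ne.
    have tail0 : (fun n => xi n.+1) = fun=> false.
      apply/funext => n; apply/negbTE; apply: contraNN ne => xn.
      by apply/eqP/half_line_a; exists n.+1.
    rewrite (ray_consE xi) tail0.
    by case: (xi 0%N); [left|right].
  exact: finite_set2.
- rewrite (_ : disp _ = set0) //; apply/seteqP; split => xi //=.
  by rewrite /disp /= half_line_spinalE eqxx.
Qed.

Lemma grig_cross w (F : seq (nat -> bool)) :
  exists xi eta, exists g : grigorchuk w,
    [/\ half_line xi, ~~ half_line eta, xi \notin F, eta \notin F &
        grig_act g eta = xi].
Proof.
have [k xF] : exists k, one_at k.*2 \notin F.
  by apply: leaves_finite => i j /one_at_inj; exact: double_inj.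
have [l yF] : exists l, one_at l.*2.+1 \notin F.
  by apply: leaves_finite => i j /one_at_inj [] /double_inj.
have [g gE] : same_orbit w (one_at l.*2.+1) (one_at k.*2).
  apply: (@cofinal_same_orbit (maxn k.*2 l.*2.+1).+1) => m.
  by rewrite gtn_max => /andP[km lm]; rewrite /one_at !gtn_eqF.
exists (one_at k.*2), (one_at l.*2.+1), g.
by rewrite !half_line_one_at /= odd_double odd_double.
Qed.

End Grigorchuk.

Theorem theorem2 (R : realType) :
  exists X : cube_complex R,
    [/\ cat0 X, infinite_complex X &
        forall w : nat -> 'I_3,
          exists act : grigorchuk w -> points X -> points X,
            cubical_action act /\ without_bounded_orbit act].
Proof.
exists (infinite_cube R half_line); split.
- exact: infinite_cube_cat0.
- apply: infinite_cube_infinite => fin; apply: infinite_nat.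
  apply: (@sub_finite_set _ _ (one_at @^-1` [set: nat -> bool])) => //.
  by apply: finite_preimage fin => i j _ _; exact: one_at_inj.
move=> w; have fin := @grig_displaced_fin w.
exists (@move_point _ _ _ (@grig_act1 w) (@grig_actM w) _ fin R); split.
  exact: move_cubical_action.
apply/unbounded_displacement_orbit/displacement_unbounded.
- exact: grig_act1.
- exact: grig_actM.
- exact: grig_displaced_fin.
- exact: grig_infinite_orbits.
- exact: grig_cross.
Qed.
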